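(* Let $\Sigma=(X,\mathcal{D},\phi)$ be a forward complete system with equilibrium point $0$. Then the following statements are equivalent: (i) $0$ is UGAS. (ii) $\Sigma$ is RFC and $0$ is a REP and iUGAS. (iii) $\Sigma$ is RFC and $0$ is a REP and iUGATT. (iv) $\Sigma$ is RFC and $0$ is a REP, UGWA and ultimately iULS. (v) $\Sigma$ is RFC and $0$ is a REP, UGWA and ultimately ULS.
   Context: Notation: $\mathbb{R}_+=[0,\infty)$; $B_r=\{x\in X: \|x\|_X<r\}$, $\overline{B_r}$ is its closure. Comparison functions: $\mathcal{K}$ is the set of continuous strictly increasing $\gamma:\mathbb{R}_+\to\mathbb{R}_+$ with $\gamma(0)=0$; $\mathcal{KL}$ is the set of continuous $\beta:\mathbb{R}_+^2\to\mathbb{R}_+$ such that $\beta(\cdot,t)\in\mathcal{K}$ for all $t\ge0$ and $\beta(r,\cdot)$ is decreasing to $0$ for all $r>0$. A forward complete system $\Sigma=(X,\mathcal{D},\phi)$ consists of a normed linear space $(X,\|\cdot\|_X)$; a set $\mathcal{D}$ of functions $d:\mathbb{R}_+\to D$ (disturbances), where $D$ is a nonempty subset of a normed linear space; and a map $\phi:\mathbb{R}_+\times X\times\mathcal{D}\to X$ (everywhere defined), such that: - shift invariance: for all $d\in\mathcal{D}$, $\tau\ge0$, $d(\cdot+\tau)\in\mathcal{D}$; - concatenation: for all $d_1,d_2\in\mathcal{D}$ and $t>0$ the function equal to $d_1(\tau)$ for $\tau\in[0,t]$ and to $d_2(\tau-t)$ for $\tau>t$ is in $\mathcal{D}$; -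 identity: $\phi(0,x,d)=x$ for all $(x,d)$; - causality: if $d(s)=\tilde d(s)$ for all $s\in[0,t]$, then $\phi(t,x,d)=\phi(t,x,\tilde d)$; - continuity: for each $(x,d)$ the map $t\mapsto\phi(t,x,d)$ is continuous; - cocycle property: $\phi(h,\phi(t,x,d),d(t+\cdot))=\phi(t+h,x,d)$ for all $t,h\ge0$, $x\in X$, $d\in\mathcal{D}$. $0\in X$ is an equilibrium point (fixed point) if $\phi(t,0,d)=0$ for all $t\ge0$, $d\in\mathcal{D}$. Notions: - RFC (robustly forward complete): for all $C>0$, $\tau>0$, $\sup\{\|\phi(t,x,d)\|_X:\|x\|_X\le C,\ t\in[0,\tau],\ d\in\mathcal{D}\}<\infty$. - REP (robust equilibrium point): $0$ is an equilibrium point and for every $\varepsilon>0$, $h>0$ there is $\delta=\delta(\varepsilon,h)>0$ such that $t\in[0,h]$, $\|x\|_X\le\delta$, $d\in\mathcal{D}$ imply $\|\phi(t,x,d)\|_X\le\varepsilon$. - UGAS (uniformly globally asymptotically stable): there is $\beta\in\mathcal{KL}$ with $\|\phi(t,x,d)\|_X\le\beta(\|x\|_X,t)$ for all $x\in X$, $d\in\mathcal{D}$, $t\ge0$. - UGWA (uniformly globally weakly attractive): for every $\varepsilon>0$ and $r>0$ there is $\tau=\tau(\varepsilon,r)$ such that for all $\|x\|_X\le r$ and $d\in\mathcal{D}$ there is $t\le\tau$ (depending on $x,d,\varepsilon$), $t\ge 0$, with $\|\phi(t,x,d)\|_X\le\varepsilon$. - ultimately ULS (ultimately uniformly stable): for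 every $\varepsilon>0$ there are $T=T(\varepsilon)>0$ and $\delta=\delta(\varepsilon)>0$ such that $t\ge T$, $\|x\|_X\le\delta$, $d\in\mathcal{D}$ imply $\|\phi(t,x,d)\|_X\le\varepsilon$. - ultimately iULS (ultimately locally integrally stable): there is $\alpha\in\mathcal{K}$ such that for every $\varepsilon>0$ there are $T=T(\varepsilon)>0$ and $\delta=\delta(\varepsilon)>0$ such that $\|x\|_X\le\delta$, $d\in\mathcal{D}$ imply $\int_{T}^\infty\alpha(\|\phi(s,x,d)\|_X)\,ds\le\varepsilon$. - iUGATT (integrally uniformly globally attractive): there is $\alpha\in\mathcal{K}$ such that for all $r>0$, $\lim_{t\to\infty}\sup_{x\in\overline{B_r},\,d\in\mathcal{D}}\int_t^\infty\alpha(\|\phi(s,x,d)\|_X)\,ds=0$. - iUGAS (integrally uniformly globally asymptotically stable): there are $\alpha\in\mathcal{K}$, $\beta\in\mathcal{KL}$ such that $\int_t^\infty\alpha(\|\phi(s,x,d)\|_X)\,ds\le\beta(\|x\|_X,t)$ for all $x\in X$, $d\in\mathcal{D}$, $t\ge0$. *)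

(* Defs.v *)
(* MathComp-Analysis. *)
From HB Require Import structures.
From mathcomp Require Import all_boot all_order all_algebra.
From mathcomp Require Import all_classical all_reals all_analysis.

Set Implicit Arguments.
Unset Strict Implicit.
Unset Printing Implicit Defensive.

Import Order.TTheory GRing.Theory Num.Theory.
Import numFieldNormedType.Exports.

Local Open Scope classical_set_scope.
Local Open Scope ring_scope.

(* Functions on [0, +oo[ are represented by functions on R, about which nothing
   is required or used at negative arguments. *)

Definition class_K (R : realType) (gamma : R -> R) : Prop :=
  [/\ {within `[0, +oo[, continuous gamma},
      {in `[0, +oo[ &, {homo gamma : r s / r < s}},
      forall r : R, 0 <= r -> 0 <= gamma r
    & gamma 0 = 0].

(* "Decreasing" is understood in the wide sense. *)
Definition class_KL (R : realType) (beta : R -> R -> R) : Prop :=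
  [/\ {within [set p : R * R | 0 <= p.1 /\ 0 <= p.2],
         continuous (fun p : R * R => beta p.1 p.2)},
      forall t : R, 0 <= t -> class_K (beta ^~ t)
    & forall r : R, 0 < r ->
        {in `[0, +oo[ &, {homo beta r : s t / s <= t >-> t <= s}} /\
        beta r t @[t --> +oo] --> (0 : R)].

Definition time_shift (R : realType) (W : Type) (tau : {nonneg R})
    (d : {nonneg R} -> W) : {nonneg R} -> W :=
  fun s => d (s%:num + tau%:num)%:nng.

(* Only the values of [flow] at nonnegative times and at elements of
   [disturbances] are meaningful. In [flow_concat], [d] is the concatenation of
   [d1] and [d2] at time [t]: the two conditions determine all its values. *)
Record fc_system (R : realType) (X W : normedModType R) := FCSystem {
  disturbance_values : set W;
  disturbances : set ({nonneg R} -> W);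
  flow : R -> X -> ({nonneg R} -> W) -> X;
  disturbance_values_neq0 : disturbance_values !=set0;
  disturbances_valued : forall d, disturbances d ->
    forall s, disturbance_values (d s);
  flow_shift : forall d (tau : {nonneg R}),
    disturbances d -> disturbances (time_shift tau d);
  flow_concat : forall d1 d2 d (t : {nonneg R}),
    disturbances d1 -> disturbances d2 -> 0 < t%:num ->
    (forall s : {nonneg R}, s%:num <= t%:num -> d s = d1 s) ->
    (forall s : {nonneg R}, 0 < s%:num -> d (s%:num + t%:num)%:nng = d2 s) ->
    disturbances d;
  flow_id : forall x d, disturbances d -> flow 0 x d = x;
  flow_causal : forall (t : {nonneg R}) x d d',
    disturbances d -> disturbances d' ->
    (forall s : {nonneg R}, s%:num <= t%:num -> d s = d' s) ->
    flow t%:num x d = flow t%:num x d';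
  flow_continuous : forall x d, disturbances d ->
    {within `[0, +oo[, continuous (fun t : R => flow t x d)};
  flow_cocycle : forall (t h : {nonneg R}) x d, disturbances d ->
    flow h%:num (flow t%:num x d) (time_shift t d) =
    flow (t%:num + h%:num) x d
}.

(* Supremum in [0, +oo], so that the supremum of the empty set is 0. *)
Definition nneg_sup (R : realType) (A : set (\bar R)) : \bar R :=
  ereal_sup (0%E |` A).

Definition equilibrium (R : realType) (X W : normedModType R)
    (S : fc_system X W) : Prop :=
  forall (t : R) d, 0 <= t -> disturbances S d -> flow S t 0 d = 0.

(* \int_t^oo alpha(||phi(s, x, d)||) ds, as an extended real number. *)
Definition tail_integral (R : realType) (X W : normedModType R)
    (S : fc_system X W) (alpha : R -> R) (t : R) (x : X)
    (d : {nonneg R} -> W) : \bar R :=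
  (\int[lebesgue_measure]_(s in `[t, +oo[) (alpha `|flow S s x d|%R)%:E)%E.

Definition RFC (R : realType) (X W : normedModType R)
    (S : fc_system X W) : Prop :=
  forall C tau : R, 0 < C -> 0 < tau ->
    (nneg_sup [set y | exists (t : R) x d,
       [/\ (`|x| <= C)%R, (0 <= t <= tau)%R, disturbances S d
         & y = (`|flow S t x d|%R)%:E]] < +oo)%E.

Definition REP (R : realType) (X W : normedModType R)
    (S : fc_system X W) : Prop :=
  equilibrium S /\
  forall eps h : R, 0 < eps -> 0 < h -> exists2 delta : R, 0 < delta &
    forall (t : R) x d, 0 <= t <= h -> `|x| <= delta -> disturbances S d ->
      `|flow S t x d| <= eps.

Definition UGAS (R : realType) (X W : normedModType R)
    (S : fc_system X W) : Prop :=
  exists2 beta : R -> R -> R, class_KL beta &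
    forall x d (t : R), disturbances S d -> 0 <= t ->
      `|flow S t x d| <= beta `|x| t.

Definition UGWA (R : realType) (X W : normedModType R)
    (S : fc_system X W) : Prop :=
  forall eps r : R, 0 < eps -> 0 < r -> exists tau : R,
    forall x d, `|x| <= r -> disturbances S d ->
      exists2 t : R, 0 <= t <= tau & `|flow S t x d| <= eps.

Definition ultimately_ULS (R : realType) (X W : normedModType R)
    (S : fc_system X W) : Prop :=
  forall eps : R, 0 < eps -> exists T delta : R, [/\ 0 < T, 0 < delta &
    forall (t : R) x d, T <= t -> `|x| <= delta -> disturbances S d ->
      `|flow S t x d| <= eps].

Definition ultimately_iULS (R : realType) (X W : normedModType R)
    (S : fc_system X W) : Prop :=
  exists2 alpha : R -> R, class_K alpha &
    forall eps : R, 0 < eps -> exists T delta : R, [/\ 0 < T, 0 < delta &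
      forall x d, `|x| <= delta -> disturbances S d ->
        (tail_integral S alpha T x d <= eps%:E)%E].

Definition iUGATT (R : realType) (X W : normedModType R)
    (S : fc_system X W) : Prop :=
  exists2 alpha : R -> R, class_K alpha &
    forall r : R, 0 < r ->
      nneg_sup [set y | exists x d,
        [/\ closed_ball (0 : X) r x, disturbances S d
          & y = tail_integral S alpha t x d]] @[t --> +oo] --> 0%E.

Definition iUGAS (R : realType) (X W : normedModType R)
    (S : fc_system X W) : Prop :=
  exists alpha : R -> R, exists beta : R -> R -> R,
    [/\ class_K alpha, class_KL beta &
      forall x d (t : R), disturbances S d -> 0 <= t ->
        (tail_integral S alpha t x d <= (beta `|x| t)%:E)%E].

(* Main.v *)
(** (i) => (ii): every KL function is bounded by a product [A r * B t], with
    [A] of class K and [B] decreasing to 0. Choosing [alpha] of class K so flat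
    at 0 that [alpha (sqrt (B s)) <= exp (- 2 s)], the function
    [alpha (A r * B s)] is at most [A' r * exp (- s)] for some [A'] of class K,
    and the tail integral at [t] is at most [A' r * exp (- t)].

    (iii) => (iv) => (v): if the integral of [alpha (`|flow|)] over a half line
    is less than [alpha eps], then every unit interval of that half line
    contains a time at which the norm of the flow is at most [eps]; REP, applied
    from that time on, carries the bound over a bounded stretch of time.

    (v) => (i): REP handles the bounded initial period left out by ultimate
    stability, so 0 is uniformly stable; with weak attractivity and the cocycle
    property it is uniformly attractive. With RFC, the supremum [M r t] of
    [`|flow s x d|] over [`|x| <= r] and [s >= t] is finite, tends to 0 as
    [t] tends to infinity, and [M r 0] tends to 0 with [r]; such an [M] is
    dominated by a product [A r * B t] as above. *)

Require Import Defs.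
From mathcomp Require Import all_boot all_order all_algebra.
From mathcomp Require Import all_classical all_reals all_analysis.
From mathcomp Require Import measurable_realfun ring lra.

Set Implicit Arguments.
Unset Strict Implicit.
Unset Printing Implicit Defensive.

Import Order.TTheory GRing.Theory Num.Theory.
Import numFieldNormedType.Exports.

Local Open Scope classical_set_scope.
Local Open Scope ring_scope.

(** * Majorants by comparison functions *)

Section Envelope.
Variable R : realType.
Implicit Types (Q : set (R * R)) (r s t e z : R).

(* An infimum of functions that are nonincreasing and 1-Lipschitz, hence itself
   so: it produces continuous majorants without integration. *)
Definition envelope Q t := inf [set q.1 + Num.max 0 (q.2 - t) | q in Q].

(** These conditions make the infimum a genuine one, bounded below by 0, rather than a default
    value. *)
Definition envelope_data Q := Q !=set0 /\ forall e z, Q (e, z) -> 0 <= e.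

Lemma envelope_le Q e z t : envelope_data Q -> Q (e, z) ->
  envelope Q t <= e + Num.max 0 (z - t).
Proof.
move=> [_ Q0] Qez; apply: ge_inf; last by exists (e, z).
exists 0 => _ [[e' z'] /Q0 e'0 <-] /=.
by rewrite addr_ge0 // le_max lexx.
Qed.

Lemma le_envelope Q c t : envelope_data Q ->
  (forall e z, Q (e, z) -> c <= e + Num.max 0 (z - t)) -> c <= envelope Q t.
Proof.
move=> [[q Qq] _] h; apply: lb_le_inf; first by exists (q.1 + Num.max 0 (q.2 - t)), q.
by move=> _ [[e z] Qez <-]; exact: h.
Qed.

Lemma envelope_ge0 Q t : envelope_data Q -> 0 <= envelope Q t.
Proof.
move=> hQ; apply: le_envelope => // e z /(proj2 hQ) e0.
by rewrite addr_ge0 // le_max lexx.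
Qed.

Lemma envelope_nonincr Q s t : envelope_data Q -> s <= t ->
  envelope Q t <= envelope Q s.
Proof.
move=> hQ st; apply: le_envelope => // e z Qez.
apply: le_trans (envelope_le t hQ Qez) _.
by rewrite lerD2l ge_max !le_max lexx /=; apply/orP; right; lra.
Qed.

Lemma envelope_lipschitz Q s t : envelope_data Q ->
  `|envelope Q s - envelope Q t| <= `|s - t|.
Proof.
move=> hQ; suff main s' t' : envelope Q s' <= envelope Q t' + `|s' - t'|.
  rewrite ler_norml; have := main s t; have := main t s.
  by rewrite (distrC t s) => ? ?; apply/andP; split; lra.
rewrite -lerBlDr; apply: le_envelope => // e z Qez.
have := envelope_le s' hQ Qez; have := normr_ge0 (s' - t'); have := ler_norm (t' - s').
rewrite (distrC t'); by case: (leP 0 (z - s')); case: (leP 0 (z - t')) => ? ? ? ? ?; lra.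
Qed.

Lemma envelope_continuous Q : envelope_data Q -> continuous (envelope Q).
Proof.
move=> hQ t; apply/cvgrPdist_lt => e e0; near=> s.
apply: le_lt_trans (envelope_lipschitz _ _ hQ) _.
by near: s; apply: cvgr_dist_lt.
Unshelve. all: by end_near. Qed.

Lemma envelope_cvg0 Q : envelope_data Q ->
  (forall eps : R, 0 < eps -> exists e z, Q (e, z) /\ e <= eps) ->
  envelope Q t @[t --> +oo] --> (0 : R).
Proof.
move=> hQ Qsmall; apply/cvgr0Pnorm_le => eps eps0.
have [e [z [Qez ee]]] := Qsmall _ eps0.
near=> t; rewrite ger0_norm ?envelope_ge0//.
apply: le_trans (envelope_le t hQ Qez) _.
rewrite max_l ?addr0// subr_le0.
by near: t; exact: (nbhs_pinfty_ge (num_real z)).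
Unshelve. all: by end_near. Qed.

End Envelope.

(** Meant for suprema, which inherit monotonicity and smallness near 0 but not continuity.
    Continuity of [A] on the whole line is kept for [class_KL_product]. *)
Lemma class_K_majorant (R : realType) (a : R -> R) :
  (forall r, 0 <= r -> 0 <= a r) ->
  (forall r s, 0 <= r -> r <= s -> a r <= a s) ->
  (forall eps, 0 < eps -> exists2 delta, 0 < delta & a delta <= eps) ->
  exists A : R -> R,
    [/\ continuous A, class_K A & forall r, 0 <= r -> a r <= A r].
Proof.
move=> a0 a_nd a_small.
(* The majorant is [D r^-1 / E r + r]: [D r^-1] dominates the bounded function
   [a / (1 + a)] and controls the behaviour at 0, while [E] minorizes
   [1 / (1 + a)] and absorbs the growth at infinity. *)
pose E := envelope [set q | exists2 z, 0 <= z & q = ((1 + a z)^-1, z)].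
pose D := envelope [set q | exists2 d, 0 < d & q = (a d, 1 + d^-1)].
have hE : envelope_data [set q | exists2 z, 0 <= z & q = ((1 + a z)^-1, z)].
  split; first by exists ((1 + a 0)^-1, 0), 0.
  by move=> _ _ [z z0 [-> _]]; rewrite invr_ge0 addr_ge0// a0.
have hD : envelope_data [set q | exists2 d, 0 < d & q = (a d, 1 + d^-1)].
  split; first by exists (a 1, 1 + 1^-1), 1.
  by move=> _ _ [z z0 [-> _]]; exact/a0/ltW.
(* Points [z] beyond [r + 1] contribute at least 1 through the maximum, the others at least the
   value at [r + 1]. *)
have E_gt0 r : 0 <= r -> 0 < E r.
  move=> r0; have r10 : 0 <= r + 1 by lra.
  have lb : 0 < (1 + a (r + 1))^-1.
    by rewrite invr_gt0; have := a0 _ r10; lra.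
  apply: lt_le_trans lb _; apply: le_envelope => // _ _ [z z0 [-> ->]].
  have az := a0 _ z0; have ar := a0 _ r10.
  have [zr|rz] := leP z (r + 1).
    rewrite -[leLHS]addr0 lerD ?le_max ?lexx// lef_pV2 ?posrE; [|lra|lra].
    by rewrite lerD2l a_nd.
  have h1 : (1 + a (r + 1))^-1 <= 1 by rewrite invf_le1; lra.
  have h2 : 0 <= (1 + a z)^-1 by rewrite invr_ge0; lra.
  have h3 : z - r <= Num.max 0 (z - r) by rewrite le_max lexx orbT.
  lra.
have E_le r : 0 <= r -> E r <= (1 + a r)^-1.
  move=> r0; have := envelope_le (e := (1 + a r)^-1) (z := r) r hE.
  by rewrite subrr maxxx addr0; apply; exists r.
have D_ge0 t : 0 <= D t by exact: envelope_ge0.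
(* If [r <= d], monotonicity of [a] suffices; if [d < r], the shift in [1 + d^-1] makes the maximum
   at least 1, which exceeds the quotient. *)
have D_ge r : 0 < r -> a r / (1 + a r) <= D r^-1.
  move=> r0; have ar := a0 _ (ltW r0).
  apply: le_envelope => // _ _ [d d0 [-> ->]].
  have ad := a0 _ (ltW d0).
  have m0 : 0 <= Num.max 0 (1 + d^-1 - r^-1) by rewrite le_max lexx.
  have [rd|dr] := leP r d.
    rewrite -[leLHS]addr0 lerD//; apply: le_trans (a_nd _ _ (ltW r0) rd).
    by rewrite ler_pdivrMr; [nra|lra].
  have h1 : a r / (1 + a r) <= 1 by rewrite ler_pdivrMr; lra.
  have h2 : r^-1 <= d^-1 by rewrite lef_pV2 ?posrE// ltW.
  have h3 : 1 + d^-1 - r^-1 <= Num.max 0 (1 + d^-1 - r^-1).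
    by rewrite le_max lexx orbT.
  lra.
(* [D] and [E] are only monotone; the summand [r] makes [A] strictly increasing. *)
pose A r := if r <= 0 then 0 else D r^-1 / E r + r.
have A_gt0 r : 0 < r -> A r = D r^-1 / E r + r by rewrite /A; case: leP.
have DE_ge0 r : 0 < r -> 0 <= D r^-1 / E r.
  by move=> r0; rewrite divr_ge0// ltW// E_gt0// ltW.
have cA : continuous A.
  move=> x; rewrite /continuous_at; have [x0|x0|->] := ltgtP x 0.
  + have -> : A x = 0 by rewrite /A ltW.
    apply: (cvg_trans _ (@cvg_cst _ (0 : R) _ (nbhs x) _)).
    apply: near_eq_cvg; near=> y; rewrite /A ifT// ltW//.
    by near: y; exact: lt_nbhsl.
  + rewrite A_gt0//.
    have h : D y^-1 / E y + y @[y --> x] --> D x^-1 / E x + x.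
      apply: cvgD; last exact: cvg_id.
      apply: cvgM.
        apply: (@cvg_comp _ _ _ (fun r : R => r^-1) D _ (nbhs x^-1)).
          by apply: cvgV; [exact: lt0r_neq0|exact: cvg_id].
        exact: envelope_continuous.
      apply: cvgV; first by rewrite lt0r_neq0// E_gt0// ltW.
      exact: envelope_continuous.
    apply: cvg_trans h; apply: near_eq_cvg; near=> y; rewrite A_gt0//.
    by near: y; exact: lt_nbhsr.
  + have -> : A 0 = 0 by rewrite /A lexx.
    apply/cvgr0Pnorm_le => eps eps0.
    have E1 : 0 < E 1 by exact: E_gt0.
    (* Once [y^-1] reaches [1 + d^-1], the pair given by [d] bounds [D y^-1] by [a d], while [E y]
       is at least [E 1] for [y <= 1]. *)
    have [|d d0 ad] := a_small (eps / 2 * E 1); first by rewrite mulr_gt0// divr_gt0.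
    have d10 : 0 < 1 + d^-1 by rewrite addr_gt0// invr_gt0.
    near=> y; have [y0|y0] := leP y 0.
      by rewrite /A y0 normr0 ltW.
    have y1 : y <= 1 by apply/ltW; near: y; exact: lt_nbhsl.
    have y2 : y <= eps / 2 by apply/ltW; near: y; apply: lt_nbhsl; lra.
    have y3 : y <= (1 + d^-1)^-1.
      by apply/ltW; near: y; apply: lt_nbhsl; rewrite invr_gt0.
    rewrite A_gt0// ger0_norm; last by have := DE_ge0 _ y0; lra.
    suff : D y^-1 / E y <= eps / 2 by lra.
    have Ey : E 1 <= E y by exact: envelope_nonincr.
    rewrite ler_pdivrMr; last exact: lt_le_trans Ey.
    apply: (@le_trans _ _ (a d)).
      have := envelope_le (e := a d) (z := 1 + d^-1) y^-1 hD.
      rewrite max_l ?addr0; first by apply; exists d.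
      rewrite subr_le0 -[leLHS]invrK lef_pV2// posrE// invr_gt0//.
    by apply: (le_trans ad); rewrite ler_wpM2l//; lra.
exists A; split => //.
- split.
  + exact: continuous_subspaceT.
  + move=> r s; rewrite !in_itv/= !andbT => r0 s0 rs.
    have s_gt0 : 0 < s by exact: le_lt_trans rs.
    have := DE_ge0 _ s_gt0; rewrite (A_gt0 s)//.
    move: r0; rewrite le_eqVlt => /orP[/eqP <-|r0]; first by rewrite /A lexx; lra.
    have ED : D r^-1 <= D s^-1.
      by apply: envelope_nonincr => //; rewrite lef_pV2 ?posrE// ltW.
    have EE : E s <= E r by apply: envelope_nonincr => //; exact: ltW.
    have [Er Es] : 0 < E r /\ 0 < E s by split; apply: E_gt0; exact: ltW.
    rewrite A_gt0// => _; rewrite ler_ltD// ler_pM// ?lef_pV2//.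
    by rewrite invr_ge0 ltW.
  + move=> r; rewrite le_eqVlt => /orP[/eqP <-|r0]; first by rewrite /A lexx.
    by rewrite A_gt0// addr_ge0 ?DE_ge0// ltW.
  + by rewrite /A lexx.
- move=> r; rewrite le_eqVlt => /orP[/eqP <-|r0].
    rewrite /A lexx; apply/ler_addgt0Pl => eps /a_small[d d0 ad].
    by rewrite addr0; apply: le_trans ad; apply: a_nd => //; exact: ltW.
  have ar := a0 _ (ltW r0).
  rewrite A_gt0// -[leLHS]addr0 lerD ?(ltW r0)//.
  rewrite ler_pdivlMr ?E_gt0 ?(ltW r0)//.
  apply: le_trans (D_ge _ r0); rewrite ler_wpM2l// E_le// ltW.
Unshelve. all: by end_near. Qed.

(** The time factor of a KL product: positivity keeps the product strictly increasing in the
    radius. *)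
Definition vanishing (R : realType) (B : R -> R) : Prop :=
  [/\ continuous B, {homo B : s t / s <= t >-> t <= s},
      forall t, 0 < B t & B t @[t --> +oo] --> (0 : R)].

Lemma class_KL_product (R : realType) (A B : R -> R) :
  continuous A -> class_K A -> vanishing B ->
  class_KL (fun r t => A r * B t).
Proof.
move=> cA KA [cB B_ni B_gt0 B0]; split.
- apply: continuous_subspaceT => p; apply: cvgM.
    by apply: (@cvg_comp _ _ _ fst A _ (nbhs p.1)); [exact: cvg_fst|exact: cA].
  by apply: (@cvg_comp _ _ _ snd B _ (nbhs p.2)); [exact: cvg_snd|exact: cB].
- move=> t t0; case: KA => _ A_incr A_ge0 A0; split.
  + by apply: continuous_subspaceT => r; apply: cvgMl; exact: cA.
  + by move=> r s r0 s0 rs; rewrite ltr_pM2r// A_incr.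
  + by move=> r r0; rewrite mulr_ge0 ?A_ge0// ltW.
  + by rewrite A0 mul0r.
- move=> r r0; case: KA => _ _ A_ge0 _; split.
    by move=> s t _ _ st; rewrite ler_wpM2l ?A_ge0 ?B_ni// ltW.
  by rewrite -(mulr0 (A r)); apply: cvgMr.
Qed.

Lemma vanishing_expRN (R : realType) : vanishing (fun t : R => expR (- t)).
Proof.
split.
- move=> t; apply: (@cvg_comp _ _ _ -%R expR _ (nbhs (- t))).
    by apply: cvgN; exact: cvg_id.
  exact: continuous_expR.
- by move=> s t st; rewrite ler_expR lerN2.
- by move=> t; exact: expR_gt0.
- exact: cvgr_expR.
Qed.

(** Applied both to a given KL function and to a supremum over trajectories. As [M r] is
    nonincreasing, one small value for each [eps] amounts to convergence to 0. *)
Lemma product_majorant (R : realType) (M : R -> R -> R) :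
  (forall r t, 0 <= r -> 0 <= t -> 0 <= M r t) ->
  (forall r s t, 0 <= r -> r <= s -> 0 <= t -> M r t <= M s t) ->
  (forall r s t, 0 <= r -> 0 <= s -> s <= t -> M r t <= M r s) ->
  (forall r eps, 0 <= r -> 0 < eps -> exists2 t, 0 <= t & M r t <= eps) ->
  (forall eps, 0 < eps -> exists2 delta, 0 < delta & M delta 0 <= eps) ->
  exists A B : R -> R, [/\ continuous A, class_K A, vanishing B &
    forall r t, 0 <= r -> 0 <= t -> M r t <= A r * B t].
Proof.
move=> M_ge0 M_nd M_ni M_cvg M_small.
(* Every pair [(e, 1 + z)] of [Q] satisfies [M r t <= G r * e] for [t >= z],
   where [G r = (1 + r) * (1 + M r 0)]: if [r <= N] because [M N z <= e], and if
   [N < r] because [1 <= (1 + r) * e]. The geometric mean with the bound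
   [M r t <= M r 0] then makes the first factor small at [r = 0]. *)
pose Q : set (R * R) := [set q | exists N z : R,
  [/\ 0 <= N, 0 <= z, M N z <= (1 + N)^-1 & q = ((1 + N)^-1, 1 + z)]].
have Q_small N : 0 <= N -> exists z, Q ((1 + N)^-1, z).
  move=> N0; have [|z z0 MNz] := M_cvg N (1 + N)^-1 N0.
    by rewrite invr_gt0; lra.
  by exists (1 + z), N, z.
have hQ : envelope_data Q.
  split; first by have [z Qz] := Q_small 0 (lexx _); exists ((1 + 0)^-1, z).
  by move=> _ _ [N [z [N0 _ _ [-> _]]]]; rewrite invr_ge0; lra.
pose G r := (1 + r) * (1 + M r 0).
have G_ge1 r : 0 <= r -> 1 <= G r.
  by move=> r0; have := M_ge0 r 0 r0 (lexx _); rewrite /G; nra.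
have MG r t : 0 <= r -> 0 <= t -> M r t <= G r * envelope Q t.
  move=> r0 t0; have G1 := G_ge1 _ r0.
  have M00 := M_ge0 r 0 r0 (lexx _).
  have Mt0 : M r t <= M r 0 by exact: M_ni.
  rewrite mulrC -ler_pdivrMr; last lra.
  apply: le_envelope => // _ _ [N [z [N0 z0 MNz [-> ->]]]].
  have i0 : 0 < (1 + N)^-1 by rewrite invr_gt0; lra.
  have m0 : 0 <= Num.max 0 (1 + z - t) by rewrite le_max lexx.
  have m1 : 1 + z - t <= Num.max 0 (1 + z - t) by rewrite le_max lexx orbT.
  rewrite ler_pdivrMr; last lra.
  (* Before time [z] the maximum is at least 1, and [G r] alone dominates [M r 0]. *)
  have [zt|tz] := leP z t; last first.
    apply: (@le_trans _ _ (1 * G r)); first by rewrite /G; nra.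
    by rewrite ler_wpM2r//; lra.
  have [rN|Nr] := leP r N.
    have : M r t <= (1 + N)^-1.
      apply: le_trans MNz; apply: (le_trans (M_nd r N t r0 rN t0)).
      exact: M_ni.
    nra.
  apply: (@le_trans _ _ ((1 + N)^-1 * G r)); last by rewrite ler_wpM2r//; lra.
  by rewrite mulrC ler_pdivlMr ?/G; [nra|lra].
have [||eps eps0|A [cA KA aA]] :=
    @class_K_majorant R (fun r => Num.sqrt (M r 0 * G r)).
- by move=> r _; exact: sqrtr_ge0.
- move=> r s r0 rs; rewrite ler_wsqrtr//.
  have h0 := M_ge0 r 0 r0 (lexx _).
  have h1 : M r 0 <= M s 0 by exact: M_nd.
  have G1 := G_ge1 _ r0.
  have G2 : G r <= G s by rewrite /G; nra.
  by rewrite ler_pM//; lra.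
(* When [r] and [M r 0] are at most 1, [G r] is at most 4, which the divisor 4 cancels. *)
- have [|d d0 Md] := M_small (Num.min 1 (eps ^+ 2 / 4)).
    by rewrite lt_min ltr01/= divr_gt0// exprn_gt0.
  have m0 : 0 < Num.min 1 d by rewrite lt_min ltr01.
  exists (Num.min 1 d) => //.
  rewrite -[leRHS](gtr0_norm eps0) -sqrtr_sqr ler_wsqrtr//.
  have m1 : Num.min 1 d <= 1 by rewrite ge_min lexx.
  have : M (Num.min 1 d) 0 <= M d 0.
    by apply: M_nd => //; [exact: ltW|rewrite ge_min lexx orbT].
  move=> /le_trans /(_ Md); rewrite le_min /G => /andP[M1 M2].
  have M3 := M_ge0 _ 0 (ltW m0) (lexx _).
  have : (1 + Num.min 1 d) * (1 + M (Num.min 1 d) 0) <= 4 by nra.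
  by nra.
have [cX X_ni X_gt0 X0] := vanishing_expRN R.
(* The envelope may reach 0; the exponential keeps the time factor positive. *)
exists A, (fun t => Num.sqrt (envelope Q t) + expR (- t)); split => //.
- split.
  + move=> t; apply: cvgD; last exact: cX.
    apply: (@cvg_comp _ _ _ (envelope Q) Num.sqrt _ (nbhs (envelope Q t))).
      exact: envelope_continuous.
    exact: sqrt_continuous.
  + move=> s t st; rewrite lerD ?X_ni// ler_wsqrtr//.
    exact: envelope_nonincr.
  + by move=> t; rewrite ltr_wpDl ?sqrtr_ge0.
  + rewrite -(addr0 0); apply: cvgD => //.
    rewrite -(sqrtr0 R).
    apply: (@cvg_comp _ _ _ (envelope Q) Num.sqrt _ (nbhs (0 : R))).
      apply: envelope_cvg0 => // eps eps0.
      have ie0 : 0 < eps^-1 by rewrite invr_gt0.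
      have [z Qz] := Q_small _ (ltW ie0).
      exists (1 + eps^-1)^-1, z; split => //.
      by rewrite -[leRHS]invrK lef_pV2 ?posrE//; lra.
    exact: sqrt_continuous.
- move=> r t r0 t0; apply: (@le_trans _ _ (A r * Num.sqrt (envelope Q t))).
    have e0 := envelope_ge0 t hQ.
    apply: (@le_trans _ _ (Num.sqrt (M r 0 * G r) * Num.sqrt (envelope Q t))).
      have G1 := G_ge1 _ r0.
      have M00 := M_ge0 r 0 r0 (lexx _).
      have Mt := M_ge0 _ _ r0 t0.
      rewrite -sqrtrM; last by rewrite mulr_ge0//; lra.
      rewrite -[leLHS](ger0_norm Mt) -sqrtr_sqr ler_wsqrtr//.
      by rewrite expr2 -mulrA ler_pM ?MG ?M_ni.
    by rewrite ler_wpM2r ?sqrtr_ge0 ?aA.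
  rewrite ler_wpM2l//; first by case: KA => _ _ + _; apply.
  by rewrite lerDl ltW.
Qed.

(** * Class K estimates and exponential decay *)

Lemma class_K_le (R : realType) (gamma : R -> R) (r s : R) :
  class_K gamma -> 0 <= r -> r <= s -> gamma r <= gamma s.
Proof.
move=> [_ g_incr _ _] r0; rewrite le_eqVlt => /orP[/eqP ->//|rs].
by apply/ltW/g_incr => //; rewrite in_itv/= andbT//; lra.
Qed.

Lemma class_K_gt0 (R : realType) (gamma : R -> R) (r : R) :
  class_K gamma -> 0 < r -> 0 < gamma r.
Proof.
move=> [_ g_incr _ g0] r0; rewrite -g0.
by apply: g_incr => //; rewrite in_itv/= andbT//; lra.
Qed.

Lemma class_K_small (R : realType) (gamma : R -> R) (eps : R) :
  class_K gamma -> 0 < eps -> exists2 delta, 0 < delta & gamma delta <= eps.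
Proof.
move=> [/subspace_continuousP cg _ _ g0] eps0.
have : gamma @ within `[0, +oo[ (nbhs (0 : R)) --> (0 : R).
  by rewrite -[X in _ --> X]g0; apply: cg; rewrite /= in_itv/= lexx.
move=> /cvgr0Pnorm_le /(_ _ eps0); rewrite near_withinE.
move=> /nbhs_ballP[e /= e0 be]; exists (e / 2); first by rewrite divr_gt0.
apply: (le_trans (ler_norm _)); apply: be; last first.
  by rewrite /= in_itv/= andbT ltW// divr_gt0.
by rewrite /ball/= sub0r normrN gtr0_norm ?divr_gt0//; lra.
Qed.

Lemma exp_decay_comp (R : realType) (A B : R -> R) :
  class_K A -> vanishing B ->
  exists alpha A' : R -> R, [/\ class_K alpha, class_K A', continuous A' &
    forall r s, 0 <= r -> 0 <= s ->
      alpha (A r * B s) <= A' r * expR (- s)].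
Proof.
move=> KA [_ B_ni B_gt0 B_cvg].
have A_ge0 r : 0 <= r -> 0 <= A r by case: KA => _ _ + _; exact.
have B_small eps : 0 < eps -> exists2 S, 0 <= S & forall s, S <= s -> B s <= eps.
  move=> eps0; have /cvgr0Pnorm_le /(_ _ eps0)[S [_ hS]] := B_cvg.
  (* Neighbourhoods of [+oo] contain open half lines; the added 1 gives the strict inequality. *)
  exists (Num.max 0 S + 1); first by rewrite addr_ge0// le_max lexx.
  move=> s Ss; apply: (le_trans (ler_norm _)); apply: hS.
  by apply: lt_le_trans Ss; rewrite ltr_pwDr// le_max lexx orbT.
(* Evaluated at [- y], the envelope is the infimum over [s] of
   [expR (- 2 s) + max 0 (y - sqrt (B s))]. *)
pose Q : set (R * R) :=
  [set q | exists2 s, 0 <= s & q = (expR (- (2 * s)), - Num.sqrt (B s))].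
have hQ : envelope_data Q.
  split; first by exists (expR (- (2 * 0)), - Num.sqrt (B 0)), 0.
  by move=> _ _ [s s0 [-> _]]; exact: expR_ge0.
pose a1 y := envelope Q (- y).
have a1_nd y z : y <= z -> a1 y <= a1 z.
  by move=> yz; apply: envelope_nonincr => //; rewrite lerN2.
(* From [S] on, [Num.sqrt (B s)] is at most [y / 2], so the maximum is at least [y / 2]; before [S],
   the exponential is at least [expR (- (2 * S))]. *)
have a1_gt0 y : 0 < y -> 0 < a1 y.
  move=> y0; have [|S S0 hS] := B_small ((y / 2) ^+ 2).
    by rewrite exprn_gt0// divr_gt0.
  apply: (@lt_le_trans _ _ (Num.min (y / 2) (expR (- (2 * S))))).
    by rewrite lt_min expR_gt0 divr_gt0.
  apply: le_envelope => // _ _ [s s0 [-> ->]].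
  have [/hS Bs|sS] := leP S s.
    rewrite ge_min; apply/orP; left; apply: ler_wpDl; first exact: expR_ge0.
    rewrite le_max; apply/orP; right.
    have : Num.sqrt (B s) <= y / 2.
      rewrite -[leRHS]gtr0_norm ?divr_gt0// -sqrtr_sqr.
      exact: ler_wsqrtr.
    by lra.
  rewrite ge_min; apply/orP; right; apply: ler_wpDr; first by rewrite le_max lexx.
  by rewrite ler_expR; lra.
have a1_ge0 y : 0 <= a1 y by exact: envelope_ge0.
have a1_le s y : 0 <= s -> y <= Num.sqrt (B s) -> a1 y <= expR (- (2 * s)).
  move=> s0 ys; rewrite -[leRHS]addr0.
  have -> : 0 = Num.max 0 (- Num.sqrt (B s) - - y) :> R.
    by rewrite max_l//; lra.
  by apply: envelope_le => //; exists s.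
(* The extra factor, at most 1 for [y >= 0], brings strict growth and the value 0 at 0. *)
pose alpha y := a1 y * (y / (1 + `|y|)).
have alpha_le y : 0 <= y -> alpha y <= a1 y.
  move=> y0; rewrite /alpha ger0_norm// -[leRHS]mulr1 ler_wpM2l//.
  by rewrite ler_pdivrMr; lra.
have K_alpha : class_K alpha.
  split.
  - apply: continuous_subspaceT => y; apply: cvgM.
      apply: (@cvg_comp _ _ _ -%R (envelope Q) _ (nbhs (- y))).
        by apply: cvgN; exact: cvg_id.
      exact: envelope_continuous.
    apply: cvgM; first exact: cvg_id.
    apply: cvgV; first by rewrite lt0r_neq0// ltr_wpDr.
    by apply: cvgD; [exact: cvg_cst|exact: norm_continuous].
  - move=> y z; rewrite !in_itv/= !andbT => y0 z0 yz.
    rewrite /alpha !ger0_norm//.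
    have az : 0 < a1 z by apply: a1_gt0; lra.
    apply: (@le_lt_trans _ _ (a1 z * (y / (1 + y)))).
      by apply: ler_wpM2r; [rewrite divr_ge0//; lra|exact/a1_nd/ltW].
    rewrite ltr_pM2l// ltr_pdivrMr; last lra.
    by rewrite mulrAC ltr_pdivlMr; [nra|lra].
  - by move=> y y0; rewrite /alpha ger0_norm// mulr_ge0// divr_ge0//; lra.
  - by rewrite /alpha mul0r mulr0.
have AB_ge0 r s : 0 <= r -> 0 <= A r * B s.
  by move=> r0; rewrite mulr_ge0 ?A_ge0// ltW.
have alpha_ge0 y : 0 <= y -> 0 <= alpha y by case: K_alpha => _ _ + _; exact.
have decay r : 0 <= r -> exists2 C, 0 < C &
    forall s, 0 <= s -> alpha (A r * B s) <= C * expR (- (2 * s)).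
  move=> r0; have Ar := A_ge0 _ r0.
  (* From [S] on, [A r * Num.sqrt (B s) <= 1], so [A r * B s] is at most [Num.sqrt (B s)], where
     [a1_le] applies. *)
  have [|S S0 hS] := B_small ((1 + A r)^-1 ^+ 2).
    by rewrite exprn_gt0// invr_gt0; lra.
  have al0 := alpha_ge0 _ (AB_ge0 r 0 r0).
  have e0 := expR_ge0 (2 * S).
  (* The summand 1 serves the times after [S], the other summand those before it. *)
  exists (1 + alpha (A r * B 0) * expR (2 * S)); first by nra.
  move=> s s0; have es := expR_ge0 (- (2 * s)).
  have [/hS Bs|sS] := leP S s; last first.
    apply: (@le_trans _ _ (alpha (A r * B 0))).
      by apply: class_K_le; rewrite ?AB_ge0// ler_wpM2l ?B_ni.
    have : 1 <= expR (2 * S) * expR (- (2 * s)).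
      by rewrite -expRD -[leLHS]expR0 ler_expR; lra.
    by nra.
  apply: (@le_trans _ _ (1 * expR (- (2 * s)))); last by rewrite ler_wpM2r//; nra.
  rewrite mul1r; apply: (le_trans (alpha_le _ (AB_ge0 _ _ r0))).
  apply: a1_le => //.
  have sB : Num.sqrt (B s) <= (1 + A r)^-1.
    rewrite -[leRHS]gtr0_norm ?invr_gt0; last lra.
    by rewrite -sqrtr_sqr ler_wsqrtr.
  have sB0 := sqrtr_ge0 (B s).
  have -> : A r * B s = A r * Num.sqrt (B s) * Num.sqrt (B s).
    by rewrite -mulrA -expr2 sqr_sqrtr// ltW.
  have : (1 + A r) * Num.sqrt (B s) <= 1.
    by rewrite mulrC -ler_pdivlMr ?mul1r//; lra.
  by move=> h; rewrite ler_piMl//; lra.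
(* The decay would allow the weight [expR (2 * s)]; weighting by [expR s] leaves the margin that
   makes the supremum small as [r] tends to 0. *)
pose V r : set R := [set v | exists2 s, 0 <= s & v = alpha (A r * B s) * expR s].
have exp2 s : expR (- (2 * s)) * expR s * expR s = 1 :> R.
  by rewrite -!expRD -[RHS]expR0; congr expR; lra.
have V_ub r : 0 <= r -> has_ubound (V r).
  move=> r0; have [C C0 hC] := decay _ r0; exists C => _ [s s0 ->].
  have es : 1 <= expR s by rewrite -expR0 ler_expR.
  have := exp2 s; have := hC _ s0; have := expR_ge0 (- (2 * s)).
  move=> e2 h1 h2; apply: (@le_trans _ _ (C * (expR (- (2 * s)) * expR s))).
    by rewrite mulrA ler_wpM2r// expR_ge0.
  rewrite -[leRHS]mulr1 ler_wpM2l//; first exact: ltW.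
  have : 0 <= expR (- (2 * s)) * expR s by rewrite mulr_ge0 ?expR_ge0.
  by nra.
have V0 r : V r (alpha (A r * B 0) * expR 0) by exists 0.
have [|||A' [cA' KA' hA']] := @class_K_majorant R (fun r => sup (V r)).
- move=> r r0; apply: le_trans (ub_le_sup (V_ub _ r0) (V0 r)).
  by rewrite mulr_ge0 ?expR_ge0// alpha_ge0// AB_ge0.
- move=> r r' r0 rr'; apply: ge_sup; first by exists (alpha (A r * B 0) * expR 0).
  move=> _ [s s0 ->].
  apply: (@le_trans _ _ (alpha (A r' * B s) * expR s)).
    rewrite ler_wpM2r ?expR_ge0// class_K_le// ?AB_ge0//.
    by rewrite ler_wpM2r ?(ltW (B_gt0 s))// class_K_le.
  by apply: ub_le_sup; [apply: V_ub; lra|exists s].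
(* The constant at radius 1 serves all smaller radii, hence the cap [Num.min 1 d2]. *)
- move=> eps eps0; have [C C0 hC] := decay 1 ler01.
  have [|d1 d10 ad1] := class_K_small (eps := eps ^+ 2 / C) K_alpha.
    by rewrite divr_gt0// exprn_gt0.
  have [|d2 d20 Ad2] := class_K_small (eps := d1 / B 0) KA; first exact: divr_gt0.
  have m0 : 0 < Num.min 1 d2 by rewrite lt_min ltr01.
  have m1 : Num.min 1 d2 <= 1 by rewrite ge_min lexx.
  have m2 : Num.min 1 d2 <= d2 by rewrite ge_min lexx orbT.
  exists (Num.min 1 d2) => //; move: (Num.min _ _) m0 m1 m2 => r r0 r1 r2.
  apply: ge_sup; first by exists (alpha (A r * B 0) * expR 0).
  have rge0 := ltW r0.
  move=> _ [s s0 ->].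
  (* The square of [alpha (A r * B s) * expR s] is bounded by using [h1] for one
     factor [alpha (A r * B s)] and [h2] for the other. *)
  have h1 : alpha (A r * B s) <= eps ^+ 2 / C.
    apply: le_trans ad1; apply: class_K_le; rewrite ?AB_ge0//.
    apply: (@le_trans _ _ (A r * B 0)); first by rewrite ler_wpM2l ?A_ge0 ?B_ni.
    rewrite -ler_pdivlMr//; apply: le_trans Ad2; exact: class_K_le.
  have h2 : alpha (A r * B s) <= C * expR (- (2 * s)).
    apply: le_trans (hC _ s0); apply: class_K_le; rewrite ?AB_ge0//.
    by rewrite ler_wpM2r ?(ltW (B_gt0 s))// class_K_le.
  have h0 := alpha_ge0 _ (AB_ge0 _ s rge0).
  have es := expR_ge0 s.
  rewrite -(@ler_pXn2r _ 2) ?nnegrE//; [|exact: mulr_ge0|exact: ltW].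
  apply: (@le_trans _ _ (eps ^+ 2 / C * (C * expR (- (2 * s))) * (expR s * expR s))).
    by rewrite exprMn !expr2 ler_wpM2r ?mulr_ge0// ler_pM.
  have -> : eps ^+ 2 / C * (C * expR (- (2 * s))) * (expR s * expR s) =
      eps ^+ 2 * (expR (- (2 * s)) * expR s * expR s).
    by field; rewrite gt_eqF.
  by rewrite exp2 mulr1.
exists alpha, A'; split => // r s r0 s0.
rewrite expRN ler_pdivlMr ?expR_gt0//; apply: le_trans (hA' _ r0).
by apply: ub_le_sup; [exact: V_ub|exists s].
Qed.

(** * Forward complete systems *)

Section TailIntegral.
Variables (R : realType) (X W : normedModType R) (S : fc_system X W).
Implicit Types (x : X) (d : {nonneg R} -> W) (t s r eps : R).

Lemma flow_restart t s x d : 0 <= s -> s <= t -> disturbances S d ->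
  exists2 d', disturbances S d' & flow S t x d = flow S (t - s) (flow S s x d) d'.
Proof.
move=> s0 st Dd; have ts0 : 0 <= t - s by rewrite subr_ge0.
exists (time_shift (NngNum s0) d); first exact: flow_shift.
rewrite (flow_cocycle (NngNum s0) (NngNum ts0))//=.
by congr (flow S _ x d); lra.
Qed.

Lemma class_K_flow_continuous alpha x d : class_K alpha -> disturbances S d ->
  {within `[0, +oo[, continuous (fun s => alpha `|flow S s x d|)}.
Proof.
move=> [/subspace_continuousP ca _ _ _] /(@flow_continuous _ _ _ S x).
move=> /subspace_continuousP cf; apply/subspace_continuousP => s s0.
(* [alpha] is continuous only relative to the half line, so the norm must converge in the restricted
   filter; its nonnegativity gives this. *)
apply: (@cvg_comp _ _ _ (fun u => `|flow S u x d|) alpha _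
  (within `[0, +oo[ (nbhs `|flow S s x d|))); last first.
  by apply: ca; rewrite /= in_itv/= normr_ge0.
have /cvg_norm nf := cf _ s0; move=> V /nf; apply: (@filterS R (nbhs s)) => u /=.
by move=> h u0; apply: h => //; rewrite in_itv/= normr_ge0.
Qed.

Lemma measurable_tail alpha x d t : class_K alpha -> disturbances S d ->
  0 <= t ->
  measurable_fun `[t, +oo[ (EFin \o (fun s => alpha `|flow S s x d|)).
Proof.
move=> Ka Dd t0; apply/measurable_EFinP.
apply: subspace_continuous_measurable_fun; first exact: measurable_itv.
apply: (continuous_subspaceW _ (@class_K_flow_continuous alpha x d Ka Dd)).
by move=> s; rewrite /= !in_itv/= !andbT => ?; lra.
Qed.

Lemma tail_integral_le alpha x d t c : class_K alpha -> disturbances S d ->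
  0 <= t -> 0 <= c ->
  (forall s, t <= s -> alpha `|flow S s x d| <= c * expR (- s)) ->
  (tail_integral S alpha t x d <= (c * expR (- t))%:E)%E.
Proof.
move=> Ka Dd t0 c0 h.
have cE : continuous (fun s : R => c * expR (- s)).
  by move=> s; apply: cvgMr; case: (vanishing_expRN R) => cE _ _ _; exact: cE.
have cF : continuous (fun s : R => - (c * expR (- s))).
  by move=> s; apply: cvgN; exact: cE.
have dE (s : R) : is_derive s 1 (fun s : R => - (c * expR (- s))) (c * expR (- s)).
  have -> : (fun s : R => - (c * expR (- s))) = (- c) \*: (expR \o -%R).
    by apply/funext => u; rewrite /= /GRing.scale/= mulNr.
  by apply: is_derive_eq; rewrite /GRing.scale/=; ring.
have -> : (c * expR (- t))%:E =
    (\int[lebesgue_measure]_(s in `[t, +oo[) (c * expR (- s))%:E)%E.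
  rewrite (@ge0_continuous_FTC2y _ _ (fun s => - (c * expR (- s))) _ 0)//.
  - by rewrite EFinN oppeK add0e.
  - by move=> s _; rewrite mulr_ge0 ?expR_ge0.
  - exact: continuous_subspaceT.
  - rewrite -oppr0; apply: cvgN; rewrite -(mulr0 c); apply: cvgMr.
    by case: (vanishing_expRN R).
  - by apply: cvg_at_right_filter; exact: cF.
  - by move=> s _; rewrite derive1E derive_val.
apply: ge0_le_integral => //.
- by move=> s _; rewrite lee_fin; case: Ka => _ _ + _; apply.
- exact: measurable_tail.
- apply/measurable_EFinP; apply: measurable_funTS.
  exact: continuous_measurable_fun.
- by move=> s; rewrite /= in_itv/= andbT lee_fin; exact: h.
Qed.

(** Otherwise the integrand is at least [alpha eps] on an interval of length 1 inside the half
    line. *)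
Lemma tail_integral_small alpha x d T t eps : class_K alpha ->
  disturbances S d -> 0 <= T -> T <= t -> 0 < eps ->
  (tail_integral S alpha T x d < (alpha eps)%:E)%E ->
  exists2 s, t <= s <= t + 1 & `|flow S s x d| <= eps.
Proof.
move=> Ka Dd T0 Tt eps0; apply: contraPP => nex; apply/negP; rewrite -leNgt.
have big s : t <= s <= t + 1 -> eps <= `|flow S s x d|.
  by move=> st; rewrite leNgt; apply/negP => /ltW ?; apply: nex; exists s.
have -> : (alpha eps)%:E =
    (\int[lebesgue_measure]_(s in `[t, (t + 1)%R]) (alpha eps)%:E)%E.
  rewrite integral_cst//= lebesgue_measure_itv/= lte_fin ltrDl ltr01.
  by rewrite -EFinD addrAC subrr add0r mule1.
have sub : `[t, (t + 1)] `<=` `[T, +oo[.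
  by move=> s; rewrite /= !in_itv/= andbT => /andP[? _]; lra.
apply: (@le_trans _ _ (\int[lebesgue_measure]_(s in `[t, (t + 1)%R])
    (alpha `|flow S s x d|)%:E)%E).
  apply: ge0_le_integral => //.
  - by move=> s _; rewrite lee_fin ltW// class_K_gt0.
  - by apply: measurable_funS (@measurable_tail alpha x d T Ka Dd T0).
  - move=> s; rewrite /= in_itv/= => /big es.
    by rewrite lee_fin class_K_le// ltW.
apply: ge0_subset_integral => //; first exact: measurable_tail.
by move=> s _; rewrite lee_fin; case: Ka => _ _ + _; apply.
Qed.

Lemma closed_ball0P r x : 0 < r -> closed_ball (0 : X) r x <-> `|x| <= r.
Proof. by move=> r0; rewrite closed_ballE// /closed_ball_/= sub0r normrN. Qed.

End TailIntegral.

(** * From UGAS to its integral version *)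

Section Implications.
Variables (R : realType) (X W : normedModType R) (S : fc_system X W).
Implicit Types (x : X) (d : {nonneg R} -> W) (r t eps : R).

(** Passing first to the positive radius [s] also covers [r = 0], where [class_KL] grants no
    monotonicity in time. *)
Lemma class_KL_le beta r s t : class_KL beta -> 0 < s -> 0 <= r -> r <= s ->
  0 <= t -> beta r t <= beta s 0.
Proof.
move=> [_ Kb b_ni] s0 r0 rs t0; apply: (@le_trans _ _ (beta s t)).
  exact: class_K_le (Kb _ t0) r0 rs.
by apply: (b_ni _ s0).1 => //; rewrite in_itv/= andbT.
Qed.

Lemma UGAS_RFC : UGAS S -> RFC S.
Proof.
move=> [beta KL h] C tau C0 tau0; apply: (@le_lt_trans _ _ (beta C 0)%:E).
  have b0 : 0 <= beta C 0 by case: KL => _ /(_ 0 (lexx _))[_ _ + _] _; apply; exact: ltW.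
  apply: ge_ereal_sup => _ [->|[t [x [d [xC /andP[t0 _] Dd ->]]]]]; rewrite lee_fin//.
  by apply: le_trans (h _ _ _ Dd t0) _; apply: class_KL_le.
exact: ltry.
Qed.

Lemma UGAS_REP : equilibrium S -> UGAS S -> REP S.
Proof.
move=> eqS [beta KL h]; split => // eps tau eps0 _.
have [|delta delta0 bd] := @class_K_small R (beta ^~ 0) eps _ eps0.
  by case: KL => _ + _; apply.
exists delta => // t x d /andP[t0 _] xd Dd.
apply: le_trans (h _ _ _ Dd t0) _; apply: le_trans bd.
exact: class_KL_le.
Qed.

Lemma UGAS_iUGAS : UGAS S -> iUGAS S.
Proof.
move=> [beta KL h]; have [_ Kb b_cvg] := KL.
have b0 t : 0 <= t -> beta 0 t = 0 by move=> /Kb[].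
have b_ge0 r t : 0 <= r -> 0 <= t -> 0 <= beta r t by move=> r0 /Kb[_ _ + _]; apply.
have [|||||A [B [cA KA vB AB]]] := @product_majorant R beta.
- exact: b_ge0.
- by move=> r s t r0 rs /Kb Kbt; exact: class_K_le Kbt r0 rs.
- move=> r s t r0 s0 st; move: r0; rewrite le_eqVlt => /orP[/eqP <-|r0].
    by rewrite !b0//; lra.
  by apply: (b_cvg _ r0).1 => //; rewrite in_itv/= andbT//; lra.
- move=> r eps; rewrite le_eqVlt => /orP[/eqP <-|r0] eps0.
    by exists 0; rewrite // b0// ltW.
  have /cvgr0Pnorm_le /(_ _ eps0)[T [_ hT]] := (b_cvg _ r0).2.
  exists (Num.max 0 T + 1); first by rewrite addr_ge0// le_max lexx.
  apply: (le_trans (ler_norm _)); apply: hT.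
  by rewrite ltr_pwDr// le_max lexx orbT.
- by move=> eps; apply: class_K_small; exact: Kb.
have [alpha [A' [Ka KA' cA' hA']]] := exp_decay_comp KA vB.
exists alpha, (fun r t => A' r * expR (- t)); split => //.
  exact: class_KL_product (vanishing_expRN R).
move=> x d t Dd t0; apply: tail_integral_le => //.
  by case: KA' => _ _ + _; apply.
move=> s ts; have s0 : 0 <= s by lra.
apply: le_trans (hA' _ _ (normr_ge0 x) s0); apply: class_K_le => //.
exact: le_trans (h _ _ _ Dd s0) (AB _ _ (normr_ge0 x) s0).
Qed.

(** * From integral attractivity to ultimate stability *)

Lemma iUGAS_iUGATT : iUGAS S -> iUGATT S.
Proof.
move=> [alpha [beta [Ka KL h]]]; exists alpha => // r r0.
have [_ Kb /(_ _ r0)[_ b_cvg]] := KL.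
apply: (@squeeze_cvge _ _ _ _ (cst 0%E) _ (fun t => (beta r t)%:E)).
- near=> t; have t0 : 0 <= t by near: t; exact: nbhs_pinfty_ge.
  apply/andP; split; first by apply: ereal_sup_ubound; left.
  apply: ge_ereal_sup => _ [->|[x [d [+ Dd ->]]]].
    by rewrite lee_fin; case: (Kb _ t0) => _ _ + _; apply; exact: ltW.
  move=> /(closed_ball0P _ r0) xr; apply: le_trans (h _ _ _ Dd t0) _.
  by rewrite lee_fin; apply: class_K_le (Kb _ t0) _ xr.
- exact: cvg_cst.
- by apply: cvg_EFin => //; near=> t.
Unshelve. all: by end_near. Qed.

Lemma iUGATT_tail alpha r eps : class_K alpha -> 0 < r -> 0 < eps ->
  nneg_sup [set y | exists x d,
    [/\ closed_ball (0 : X) r x, disturbances S d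
      & y = tail_integral S alpha t x d]] @[t --> +oo] --> 0%E ->
  exists2 T, 0 < T & forall x d, `|x| <= r -> disturbances S d ->
    (tail_integral S alpha T x d <= eps%:E)%E.
Proof.
move=> Ka r0 eps0 /fine_cvgP[fin /cvgr0Pnorm_le /(_ _ eps0) small].
have : \forall t \near +oo, 0 < t /\ forall x d, `|x| <= r -> disturbances S d ->
    (tail_integral S alpha t x d <= eps%:E)%E.
  near=> t; split; first by near: t; exact: nbhs_pinfty_gt.
  move=> x d xr Dd.
  apply: (@le_trans _ _ (nneg_sup [set y | exists x d,
    [/\ closed_ball (0 : X) r x, disturbances S d
      & y = tail_integral S alpha t x d]])).
    by apply: ereal_sup_ubound; right; exists x, d; split => //; exact/closed_ball0P.
  (* The supremum is eventually finite, so the bound on its real part is a bound on it. *)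
  rewrite -[leLHS]fineK; last by near: t.
  rewrite lee_fin; apply: le_trans (ler_norm _) _.
  by near: t.
by move=> /filter_ex[T [T0 hT]]; exists T.
Unshelve. all: by end_near. Qed.

Lemma iUGATT_UGWA : iUGATT S -> UGWA S.
Proof.
move=> [alpha Ka h] eps r eps0 r0; have ae0 := class_K_gt0 Ka eps0.
(* Halving turns the large inequality into the strict one that [tail_integral_small] requires. *)
have [|T T0 hT] := iUGATT_tail (eps := alpha eps / 2) Ka r0 _ (h _ r0).
  exact: divr_gt0.
exists (T + 1) => x d xr Dd.
have [||s /andP[Ts sT] small] :=
    @tail_integral_small _ _ _ S alpha x d T T eps Ka Dd _ (lexx _) eps0.
- exact: ltW.
- by apply: le_lt_trans (hT _ _ xr Dd) _; rewrite lte_fin; lra.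
by exists s => //; apply/andP; split; lra.
Qed.

Lemma iUGATT_ultimately_iULS : iUGATT S -> ultimately_iULS S.
Proof.
move=> [alpha Ka h]; exists alpha => // eps eps0.
by have [T T0 hT] := iUGATT_tail Ka ltr01 eps0 (h _ ltr01); exists T, 1.
Qed.

Lemma ultimately_iULS_ULS : REP S -> ultimately_iULS S -> ultimately_ULS S.
Proof.
move=> [_ rep] [alpha Ka h] eps eps0.
(* The horizon 1 is the length of the window [[t - 1, t]] in which a time of norm at most [delta] is
   found; the window lies after [T] when [t >= T + 1]. *)
have [delta delta0 hdelta] := rep _ _ eps0 ltr01.
have ad0 := class_K_gt0 Ka delta0.
have [|T [d0 [T0 d00 hT]]] := h (alpha delta / 2); first exact: divr_gt0.
exists (T + 1), d0; split => // [|t x d Tt xd Dd]; first by rewrite addr_gt0.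
have [|||s /andP[ts st] small] :=
    @tail_integral_small _ _ _ S alpha x d T (t - 1) delta Ka Dd _ _ delta0.
- exact: ltW.
- by lra.
- by apply: le_lt_trans (hT _ _ xd Dd) _; rewrite lte_fin; lra.
have [||d' Dd' ->] := @flow_restart _ _ _ S t s x d _ _ Dd; [lra|lra|].
by apply: hdelta => //; apply/andP; split; lra.
Qed.

(** * From stability and attractivity back to UGAS *)

Lemma REP_ULS : REP S -> ultimately_ULS S -> forall eps, 0 < eps ->
  exists2 delta, 0 < delta & forall t x d, 0 <= t -> `|x| <= delta ->
    disturbances S d -> `|flow S t x d| <= eps.
Proof.
move=> [_ rep] uls eps eps0; have [T [d1 [T0 d10 h1]]] := uls _ eps0.
have [d2 d20 h2] := rep _ _ eps0 T0.
exists (Num.min d1 d2); first by rewrite lt_min d10.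
move=> t x d t0; rewrite le_min => /andP[xd1 xd2] Dd.
have [Tt|tT] := leP T t; first exact: h1.
by apply: h2 => //; rewrite t0 ltW.
Qed.

(** The time of entry into the [delta] ball depends on [x] and [d] but is at most [tau]; restarting
    there, stability takes over for good. *)
Lemma UGWA_ULS_attractive : REP S -> UGWA S -> ultimately_ULS S ->
  forall eps r, 0 < eps -> 0 < r -> exists2 tau, 0 <= tau &
    forall t x d, tau <= t -> `|x| <= r -> disturbances S d ->
      `|flow S t x d| <= eps.
Proof.
move=> rep wa uls eps r eps0 r0.
have [delta delta0 hd] := REP_ULS rep uls eps0.
have [tau htau] := wa _ _ delta0 r0.
exists (Num.max 0 tau); first by rewrite le_max lexx.
move=> t x d; rewrite ge_max => /andP[t0 taut] xr Dd.
have [s /andP[s0 st] small] := htau _ _ xr Dd.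
have [|d' Dd' ->] := @flow_restart _ _ _ S t s x d s0 _ Dd; first exact: le_trans taut.
by apply: hd => //; lra.
Qed.

Lemma RFC_bound : RFC S -> forall C tau, 0 < C -> 0 < tau ->
  exists2 K, 0 <= K & forall t x d, `|x| <= C -> 0 <= t <= tau ->
    disturbances S d -> `|flow S t x d| <= K.
Proof.
move=> rfc C tau C0 tau0; have := rfc _ _ C0 tau0.
set s := nneg_sup _ => soo.
have s0 : (0 <= s)%E by apply: ereal_sup_ubound; left.
have sfin : s \is a fin_num by rewrite ge0_fin_numE.
exists (fine s); first exact: fine_ge0.
move=> t x d xC tt Dd; rewrite -lee_fin fineK//.
by apply: ereal_sup_ubound; right; exists t, x, d.
Qed.

Lemma RFC_attractive_UGAS : RFC S -> REP S -> UGWA S -> ultimately_ULS S ->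
  UGAS S.
Proof.
move=> rfc rep wa uls.
have uls' := REP_ULS rep uls; have att := UGWA_ULS_attractive rep wa uls.
(* Adding 0 keeps the set nonempty, even without disturbances, and its supremum nonnegative. *)
pose V r t : set R := 0 |` [set y | exists s x d,
  [/\ `|x| <= r, t <= s, disturbances S d & y = `|flow S s x d|]].
have V0 r t : V r t !=set0 by exists 0; left.
(* Attractivity gives the bound 1 after [tau], RFC the bound [K] before. The increments by 1 supply
   a positive radius and a positive horizon. *)
have V_ub r t : 0 <= r -> 0 <= t -> has_ubound (V r t).
  move=> r0 t0; have r10 : 0 < r + 1 by lra.
  have [tau tau0 htau] := att _ _ ltr01 r10.
  have tau10 : 0 < tau + 1 by lra.
  have [K K0 hK] := RFC_bound rfc r10 tau10.
  exists (Num.max 1 K) => _ [->|[s [x [d [xr ts Dd ->]]]]].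
    by rewrite le_max ler01.
  have xr1 : `|x| <= r + 1 by lra.
  rewrite le_max; have [taus|staus] := leP tau s.
    by rewrite htau.
  by rewrite hK ?orbT//; apply/andP; split; lra.
pose M r t := sup (V r t).
have M_le r t c : 0 <= c -> (forall s x d, `|x| <= r -> t <= s ->
    disturbances S d -> `|flow S s x d| <= c) -> M r t <= c.
  move=> c0 h; apply: ge_sup => // _ [->//|[s [x [d [xr ts Dd ->]]]]].
  exact: h.
have M_ge r t s x d : 0 <= r -> 0 <= t -> `|x| <= r -> t <= s ->
    disturbances S d -> `|flow S s x d| <= M r t.
  move=> r0 t0 xr ts Dd; apply: ub_le_sup; first exact: V_ub.
  by right; exists s, x, d.
have M_ge0 r t : 0 <= r -> 0 <= t -> 0 <= M r t.
  by move=> r0 t0; apply: ub_le_sup; [exact: V_ub|left].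
have [|||||A [B [cA KA vB AB]]] := @product_majorant R M.
- exact: M_ge0.
- move=> r s t r0 rs t0; have s0 := le_trans r0 rs.
  apply: M_le => [|u x d xr tu Dd]; first exact: M_ge0.
  by apply: M_ge => //; exact: le_trans rs.
- move=> r s t r0 s0 st; have t0 := le_trans s0 st.
  apply: M_le => [|u x d xr tu Dd]; first exact: M_ge0.
  by apply: M_ge => //; exact: le_trans tu.
- move=> r eps r0 eps0; have r10 : 0 < r + 1 by lra.
  have [tau tau0 htau] := att _ _ eps0 r10.
  exists tau => //; apply: M_le => [|u x d xr tu Dd]; first exact: ltW.
  by apply: htau => //; lra.
- move=> eps eps0; have [delta delta0 hd] := uls' _ eps0.
  exists delta => //; apply: M_le => [|u x d xr tu Dd]; first exact: ltW.
  exact: hd.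
exists (fun r t => A r * B t); first exact: class_KL_product.
move=> x d t Dd t0; apply: le_trans (AB _ _ (normr_ge0 x) t0).
exact: M_ge.
Qed.

End Implications.

Theorem theorem2 (R : realType) (X W : normedModType R) (S : fc_system X W)
    (eqS : equilibrium S) :
  [<-> UGAS S;
       RFC S /\ REP S /\ iUGAS S;
       RFC S /\ REP S /\ iUGATT S;
       [/\ RFC S, REP S, UGWA S & ultimately_iULS S];
       [/\ RFC S, REP S, UGWA S & ultimately_ULS S]].
Proof.
tfae.
- move=> h; split; first exact: UGAS_RFC.
  by split; [exact: UGAS_REP|exact: UGAS_iUGAS].
- by move=> [rfc [rep /iUGAS_iUGATT]].
- move=> [rfc [rep h]]; split => //; first exact: iUGATT_UGWA.
  exact: iUGATT_ultimately_iULS.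
- by move=> [rfc rep wa h]; split => //; exact: ultimately_iULS_ULS.
- by move=> [rfc rep wa h]; exact: RFC_attractive_UGAS.
Qed.
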